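(* For all $\mathfrak u,\mathfrak v\in\langle\Gamma\rangle$, $\Delta(\mathfrak u\sqcup\!\sqcup\mathfrak v)=\Delta(\mathfrak u)\sqcup\!\sqcup\Delta(\mathfrak v)$.
   Context: Let $q$ be a prime power. Let $\Gamma=\{x_{n,\varepsilon}\}_{n\in\mathbb N,\varepsilon\in\mathbb F_q^*}$ with weights $w(x_{n,\varepsilon})=n$, $\langle\Gamma\rangle$ the set of words over $\Gamma$ (empty word $1$, juxtaposition = concatenation, depth = number of letters, weight = sum of letter weights), $\mathfrak D$ the $\mathbb F_q$-vector space with basis $\langle\Gamma\rangle$; write $x_n:=x_{n,1}$. For positive integers $r,s,j$ put $\Delta^j_{r,s}=(-1)^{r-1}\binom{j-1}{r-1}+(-1)^{s-1}\binom{j-1}{s-1}$ if $(q-1)\mid j$ and $0$ otherwise. The bilinear products $\diamond,\sqcup\!\sqcup$ on $\mathfrak D$ are defined recursively by $1\diamond\mathfrak a=\mathfrak a\diamond1=\mathfrak a$, $1\sqcup\!\sqcup\mathfrak a=\mathfrak a\sqcup\!\sqcup1=\mathfrak a$ and, for nonempty $\mathfrak a=x_{a,\alpha}\mathfrak a_-$, $\mathfrak b=x_{b,\beta}\mathfrak b_-$: $\mathfrak a\diamond\mathfrak b=x_{a+b,\alpha\beta}(\mathfrak a_-\sqcup\!\sqcup\mathfrak b_-)+\sum_{i+j=a+b}\Delta^j_{a,b}x_{i,\alpha\beta}(x_j\sqcup\!\sqcup(\mathfrak a_-\sqcup\!\sqcup\mathfrak b_-))$, $\mathfrak a\sqcup\!\sqcup\mathfrak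 b=x_{a,\alpha}(\mathfrak a_-\sqcup\!\sqcup\mathfrak b)+x_{b,\beta}(\mathfrak a\sqcup\!\sqcup\mathfrak b_-)+\mathfrak a\diamond\mathfrak b$. For a word $\mathfrak a=x_{i_1}\cdots x_{i_m}$ with all characters $1$ put $[\mathfrak a]=(-1)^m\Delta^{i_1}_{1,w(\mathfrak a)+1}\cdots\Delta^{i_m}_{1,w(\mathfrak a)+1}x_{i_1}\sqcup\!\sqcup\cdots\sqcup\!\sqcup x_{i_m}$, $[1]=1$. The coproduct $\Delta:\mathfrak D\to\mathfrak D\otimes\mathfrak D$ is linear with $\Delta(1)=1\otimes1$, $\Delta(x_{n,\varepsilon})=1\otimes x_{n,\varepsilon}+\sum_{r\ge1,\ r+w(\mathfrak a)=n}\binom{r+\mathrm{depth}(\mathfrak a)-2}{\mathrm{depth}(\mathfrak a)}x_{r,\varepsilon}\otimes[\mathfrak a]$ (sum over words $\mathfrak a$ with all characters $1$), and for $\mathfrak u=x_{u,\varepsilon}\mathfrak v$ of depth $\ge2$, writing $\Delta(x_{u,\varepsilon})=1\otimes x_{u,\varepsilon}+\sum a\otimes b$ and $\Delta(\mathfrak v)=\sum a_{\mathfrak v}\otimes b_{\mathfrak v}$, $\Delta(\mathfrak u)=1\otimes\mathfrak u+\sum(a\,a_{\mathfrak v})\otimes(b\sqcup\!\sqcup b_{\mathfrak v})$. On $\mathfrak D\otimes\mathfrak D$, $(a\otimes b)\sqcup\!\sqcup(c\otimes d)=(a\sqcup\!\sqcup c)\otimes(b\sqcup\!\sqcup d)$.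 *)

(* Defs.v *)
(* The F_q-vector space D with basis the words <Gamma> is
   modelled as the free module {malg F[word F]} (finitely supported
   coefficient functions), and D (x) D as the free module on pairs of words
   {malg F[word F * word F]}. *)
From HB Require Import structures.
From mathcomp Require Import all_boot all_order all_algebra.
From mathcomp Require Import finmap.
From mathcomp.multinomials Require Import monalg.
Set Implicit Arguments.
Unset Strict Implicit.
Unset Printing Implicit Defensive.
Import GRing.Theory.
Local Open Scope ring_scope.

Definition is_letter (F : finFieldType) (x : nat * F) : bool :=
  (0 < x.1)%N && (x.2 != 0).

Definition letter (F : finFieldType) := {x : nat * F | is_letter x}.

Lemma is_letter_11 (F : finFieldType) : is_letter ((1%N, 1) : nat * F).
Proof. by rewrite /is_letter /= oner_neq0. Qed.

(* x_{n,eps}; only ever applied with n >= 1 and eps <> 0 (the default is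
   never used). *)
Definition mkx (F : finFieldType) (n : nat) (e : F) : letter F :=
  insubd (exist _ (1%N, 1) (is_letter_11 F)) (n, e).

Definition lw (F : finFieldType) (x : letter F) : nat := (val x).1.
Definition lc (F : finFieldType) (x : letter F) : F := (val x).2.

Definition word (F : finFieldType) := seq (letter F).
Definition weight (F : finFieldType) (w : word F) : nat :=
  \sum_(x <- w) lw x.

Definition D (F : finFieldType) := {malg F[word F]}.
Definition DD (F : finFieldType) := {malg F[(word F * word F)%type]}.

Definition Dco (F : finFieldType) (j r s : nat) : F :=
  if ((#|F|.-1) %| j)%N then
    ((-1) ^+ (r.-1) * ('C(j.-1, r.-1))%:R + (-1) ^+ (s.-1) * ('C(j.-1, s.-1))%:R)
  else 0.

Definition lin2 (F : finFieldType) (f : word F -> word F -> D F) (a b : D F)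
  : D F :=
  \sum_(k <- msupp a) \sum_(l <- msupp b) (a@_k * b@_l) *: f k l.

Definition pre (F : finFieldType) (x : letter F) (d : D F) : D F :=
  \sum_(k <- msupp d) d@_k *: << (x :: k) >>.

Definition diamond_step (F : finFieldType) (sh' : word F -> word F -> D F)
  (a b : word F) : D F :=
  match a, b with
  | [::], _ => << b >>
  | _, [::] => << a >>
  | x :: a', y :: b' =>
      let n := (lw x + lw y)%N in
      let e := lc x * lc y in
      pre (mkx n e) (sh' a' b') +
      \sum_(1 <= j < n)
         Dco F j (lw x) (lw y) *:
           pre (mkx (n - j) e) (lin2 sh' << [:: mkx j (1 : F)] >> (sh' a' b'))
  end.

(* shuffle with fuel; correct as soon as fuel >= size a + size b *)
Fixpoint shf (F : finFieldType) (fuel : nat) (a b : word F) : D F :=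
  match a, b with
  | [::], _ => << b >>
  | _, [::] => << a >>
  | x :: a', y :: b' =>
      match fuel with
      | 0 => 0
      | fuel'.+1 =>
          pre x (shf fuel' a' b) + pre y (shf fuel' a b')
          + diamond_step (shf fuel') a b
      end
  end.

Definition shw (F : finFieldType) (a b : word F) : D F :=
  shf (size a + size b) a b.
Definition sh (F : finFieldType) (a b : D F) : D F := lin2 (@shw F) a b.

Definition dmw (F : finFieldType) (a b : word F) : D F :=
  diamond_step (@shw F) a b.

(* such a word x_{i_1}...x_{i_m} is given by its index list [:: i_1; ..; i_m] *)
Definition word1 (F : finFieldType) (c : seq nat) : word F :=
  [seq mkx i (1 : F) | i <- c].

Definition bracket (F : finFieldType) (c : seq nat) : D F :=
  let w := sumn c in
  ((-1) ^+ size c * \prod_(i <- c) Dco F i 1 w.+1) *: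
    foldr (fun i acc => sh << [:: mkx i (1 : F)] >> acc) << [::] >> c.

(* all compositions of k, i.e. lists of positive integers summing to k
   (= all words with all characters 1 and weight k); fuel >= k *)
Fixpoint comps_f (fuel k : nat) : seq (seq nat) :=
  match fuel with
  | 0 => [:: [::]]
  | fuel'.+1 =>
      if k == 0%N then [:: [::]]
      else flatten [seq [seq i :: c | c <- comps_f fuel' (k - i)] | i <- iota 1 k]
  end.
Definition comps (k : nat) : seq (seq nat) := comps_f k k.

Definition tensw (F : finFieldType) (w : word F) (d : D F) : DD F :=
  \sum_(l <- msupp d) d@_l *: << (w, l) >>.

Definition tens (F : finFieldType) (a b : D F) : DD F :=
  \sum_(k <- msupp a) \sum_(l <- msupp b) (a@_k * b@_l) *: << (k, l) >>.

Definition shT (F : finFieldType) (X Y : DD F) : DD F :=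
  \sum_(p <- msupp X) \sum_(r <- msupp Y)
     (X@_p * Y@_r) *: tens (shw p.1 r.1) (shw p.2 r.2).

Definition catsh (F : finFieldType) (X Y : DD F) : DD F :=
  \sum_(p <- msupp X) \sum_(r <- msupp Y)
     (X@_p * Y@_r) *: tensw (p.1 ++ r.1) (shw p.2 r.2).

(* Delta(x_{n,eps}) - 1 (x) x_{n,eps}
   = sum_{r >= 1, r + w(a) = n} C(r+depth a-2, depth a) x_{r,eps} (x) [a] *)
Definition cop_letter_rest (F : finFieldType) (x : letter F) : DD F :=
  \sum_(1 <= r < (lw x).+1) \sum_(c <- comps (lw x - r))
     ('C(r + size c - 2, size c))%:R *: tensw [:: mkx r (lc x)] (bracket F c).

Fixpoint copw (F : finFieldType) (u : word F) : DD F :=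
  match u with
  | [::] => << ([::], [::]) >>
  | x :: v => << ([::], x :: v) >> + catsh (cop_letter_rest x) (copw v)
  end.

Definition cop (F : finFieldType) (d : D F) : DD F :=
  \sum_(k <- msupp d) d@_k *: copw k.

(* Main.v *)
(* For t_0, ..., t_{d-1} in a field K containing F_q, linearly independent over
   F_q, and n >= 1, let S_k(n) be the sum of a^-n over a in t_k + <t_0, ..., t_{k-1}>.
   Nested sums of these "power sums", with characters attached to the levels k,
   define an evaluation phi of words.  Partial fractions show that S_k(a) S_k(b)
   expands exactly as in the definition of the diamond product, so phi is
   multiplicative for the shuffle product.

   Split the flag as t_0, ..., t_{e-1} (spanning W) followed by t_e, ..., t_{d-1},
   and let e_W be the F_q-linear polynomial with kernel W and derivative 1.
   Summing (X + w)^-n over w in W gives a polynomial in 1 / e_W(X), the n-th Goss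
   polynomial of W, whose coefficients are the evaluations at t_0, ..., t_{e-1} of
   the right-hand tensor factors of Delta(x_n).  Hence evaluating Delta(u) at
   (e_W(t_e), ..., e_W(t_{d-1})) on the left and at (t_0, ..., t_{e-1}) on the
   right gives phi(u)(t_0, ..., t_{d-1}), which is multiplicative in u.

   Over the algebraic closure of F_q these evaluations separate the points of
   D (x) D: Goss polynomials have distinct degrees, and the characters of F_q^*
   are linearly independent. *)
Require Import Defs.
From HB Require Import structures.
From mathcomp Require Import all_boot all_order all_algebra.
From mathcomp Require Import finmap.
From mathcomp.multinomials Require Import monalg.
From mathcomp Require Import all_fingroup pgroup abelian all_field.
From mathcomp Require Import ring zify.
Set Implicit Arguments.
Unset Strict Implicit.
Unset Printing Implicit Defensive.
Import GRing.Theory.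
Local Open Scope ring_scope.

(** * Power sums over a finite field and partial fractions *)

Section FinFieldSums.

Variable F : finFieldType.

Lemma card_predK : (#|F|.-1).+1 = #|F|.
Proof. by rewrite prednK // ltnW // finNzRing_gt1. Qed.

Lemma card_pred_gt0 : (0 < #|F|.-1)%N.
Proof. by rewrite -ltnS card_predK finNzRing_gt1. Qed.

Lemma expf_card_pred (c : F) : c != 0 -> c ^+ #|F|.-1 = 1.
Proof.
by move=> c0; apply: (mulfI c0); rewrite -exprS card_predK expf_card mulr1.
Qed.

Lemma natr_card : #|F|%:R = 0 :> F.
Proof.
have /eqP : \sum_(c : F) c = \sum_(c : F) (1 + c) by rewrite (reindex_inj (addrI 1)).
by rewrite big_split /= sumr_const -subr_eq subrr eq_sym => /eqP.
Qed.

Lemma signr_dvd_card_pred (j : nat) : (#|F|.-1 %| j)%N -> (-1) ^+ j = 1 :> F.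
Proof.
by case/dvdnP=> k ->; rewrite mulnC exprM expf_card_pred ?oppr_eq0 ?oner_neq0 // expr1n.
Qed.

(** When q - 1 does not divide j, some nonzero c has c^j != 1, because X^r - 1 has at most r roots
    for r = j mod (q - 1). Substituting c x for x then multiplies the sum by c^j. *)
Lemma sum_exp (j : nat) :
  \sum_(c : F | c != 0) c ^+ j = if (#|F|.-1 %| j)%N then -1 else 0.
Proof.
case: ifP => [/dvdnP[k ->]|ndvd].
  rewrite (eq_bigr (fun _ => 1)) => [|c c0]; last first.
    by rewrite mulnC exprM expf_card_pred // expr1n.
  rewrite sumr_const; apply/eqP; rewrite -subr_eq0 opprK.
  have -> : #|[pred c : F | c != 0]| = #|F|.-1 by rewrite -(cardC1 (0 : F)).
  by rewrite natr1 card_predK natr_card.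
have [c c0 cj] : exists2 c : F, c != 0 & c ^+ j != 1.
  set r := (j %% #|F|.-1)%N.
  have r0 : (0 < r)%N by rewrite lt0n; apply/negbT.
  have [/allP h|/allPn[c]] := boolP (all r.-unity_root [seq c <- enum F | c != 0]).
    have := max_unity_roots r0 (introT allP h) (filter_uniq _ (enum_uniq _)).
    rewrite leqNgt => /negP; case.
    have -> : size [seq c <- enum F | c != 0] = #|F|.-1.
      rewrite -(cardC1 (0 : F)) cardE /enum_mem -filter_predI /=.
      by congr size; apply: eq_filter => x; rewrite !inE andbT.
    by rewrite ltn_mod card_pred_gt0.
  rewrite mem_filter => /andP[c0 _] h; exists c => //; apply: contra h => /eqP cj.
  rewrite unity_rootE; apply/eqP; move: cj.
  rewrite {1}(divn_eq j #|F|.-1) exprD mulnC exprM expf_card_pred // expr1n mul1r.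
  by [].
set S := \sum_(_ | _) _.
have SE : S = c ^+ j * S.
  rewrite mulr_sumr /S (reindex_inj (mulfI c0)) /=.
  apply: eq_big => [x|x _]; first by rewrite mulf_eq0 negb_or c0.
  by rewrite exprMn.
apply/eqP; have /eqP : (1 - c ^+ j) * S = 0 by rewrite mulrBl mul1r -SE subrr.
by rewrite mulf_eq0 subr_eq0 eq_sym (negbTE cj).
Qed.

Lemma sum_expV (j : nat) :
  \sum_(c : F | c != 0) c ^- j = if (#|F|.-1 %| j)%N then -1 else 0.
Proof.
rewrite -sum_exp (reindex_inj invr_inj) /=.
by apply: eq_big => [x|x _]; rewrite ?invr_eq0 // exprVn invrK.
Qed.

End FinFieldSums.

Section PartialFractions.

Variable R : comNzRingType.
Implicit Types x y d : R.

(* Up to sign, the pure x part of the expansion of x^a y^b when x^-1 and y^-1 differ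
   by d^-1; for b = 0 the truncated subtraction gives 'C(m - 1, m) = (m == 0). *)
Definition ppart (a b : nat) x d : R :=
  \sum_(m < a) 'C(b + m - 1, m)%:R * d ^+ (b + m) * x ^+ (a - m).

Lemma ppart_rec a b x d :
  ppart a.+1 b.+1 x d = d * (ppart a.+1 b x d + ppart a b.+1 x d).
Proof.
rewrite /ppart !big_ord_recl /= mulrDr mulrDr [d * \sum_(i < a) _]mulr_sumr.
rewrite [d * \sum_(i < a) _]mulr_sumr -!addrA -big_split /= !bin0 !mul1r !addn0.
rewrite mulrA -exprS; congr (_ + _); apply: eq_bigr => m _.
have -> : bump 0 m = m.+1 by [].
rewrite subSS !addSn !addnS !subn1 /= binS natrD !exprS; ring.
Qed.

Lemma ppart0 b x d : ppart b 0 x d = (0 < b)%:R * x ^+ b.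
Proof.
case: b => [|b]; rewrite /ppart ?big_ord0 ?mul0r // big_ord_recl big1 => [|i _].
  by rewrite /= bin0 !mul1r addr0.
by rewrite add0n lift0 subn1 bin_small ?mul0r.
Qed.

(** Replacing one factor [x * y] by [d * (x - y)] lowers the total exponent by one, and both pure
    parts obey the matching recursion [ppart_rec]. *)
Lemma partial_fraction a b x y d : x * y = d * (x - y) -> (0 < a + b)%N ->
  x ^+ a * y ^+ b = (-1) ^+ b * ppart a b x (- d) + (-1) ^+ a * ppart b a y d.
Proof.
move=> xy; move: {2}(a + b)%N (leqnn (a + b)) => n.
elim: n a b => [|n IH] a b; first by rewrite leqn0 => /eqP ->.
case: a => [|a].
  by rewrite ppart0 => _; rewrite add0n => ->; rewrite /ppart big_ord0 !expr0 !mul1r mulr0 add0r.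
case: b => [|b].
  by rewrite ppart0 => _ _; rewrite /ppart big_ord0 /= !expr0 !mul1r mulr0 addr0 mulr1.
rewrite addSn ltnS => le_n _.
have -> : x ^+ a.+1 * y ^+ b.+1 = d * (x ^+ a.+1 * y ^+ b - x ^+ a * y ^+ b.+1).
  rewrite !exprS; transitivity ((x * y) * (x ^+ a * y ^+ b)); first by ring.
  by rewrite xy; ring.
have le_n' : (a + b < n)%N by rewrite -addnS.
rewrite (IH a.+1 b) ?(IH a b.+1) ?addnS //.
by rewrite !ppart_rec !exprS; ring.
Qed.

(** Putting j = b + m brings the sum into the shape of Delta^j_{a,b}; the added terms with j < b
    vanish with their binomials. *)
Lemma ppartE a b x d : (0 < b)%N ->
  ppart a b x d =
    \sum_(1 <= j < a + b) 'C(j.-1, b.-1)%:R * d ^+ j * x ^+ (a + b - j).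
Proof.
move=> b0; rewrite (big_cat_nat (n := b)) //= ?leq_addl // big_nat_cond big1 => [|j]; last first.
  rewrite andbT => /andP[j0 jb]; rewrite bin_small ?mul0r //.
  by rewrite -ltnS !prednK.
rewrite add0r -[X in index_iota X]add0n big_addn addnK big_mkord; apply: eq_bigr => m _.
rewrite (addnC m b) (addnC a b) subnDl subn1; congr (_%:R * _ * _).
case: b b0 => // b _; rewrite addSn /=.
by rewrite -bin_sub ?leq_addl // addnK.
Qed.

End PartialFractions.

(** * Flags and their power sums *)

Section Flags.

Variables (F : finFieldType) (K : fieldType) (iota : {rmorphism F -> K}).
Implicit Types (p : seq (K * nat)) (f : K -> K).

(* Points are lists of pairs (t_k, exponent of the character at level k), with the
   top of the flag at the head. *)
Fixpoint span p : seq K :=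
  if p is x :: p' then [seq iota c * x.1 + v | c <- enum F, v <- span p']
  else [:: 0].

(** The vectors whose top nonzero coordinate is 1: for independent t_k, one on each line of the
    span. *)
Fixpoint monics p : seq K :=
  if p is x :: p' then monics p' ++ [seq x.1 + v | v <- span p'] else [::].

(** Spans are closed under scalars, so this is linear independence over F, phrased as the
    nonvanishing of the denominators in the power sums. *)
Fixpoint adm p : bool :=
  if p is x :: p' then all (fun v => x.1 + v != 0) (span p') && adm p' else true.

Lemma adm_cons x p :
  adm (x :: p) = all (fun v => x.1 + v != 0) (span p) && adm p.
Proof. by []. Qed.

Lemma sum_span_cons x p f :
  \sum_(v <- span (x :: p)) f v =
    \sum_(c : F) \sum_(v <- span p) f (iota c * x.1 + v).
Proof. by rewrite big_allpairs_dep big_enum. Qed.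

Lemma span_consP x p v :
  reflect (exists c, exists2 w, w \in span p & v = iota c * x.1 + w)
          (v \in span (x :: p)).
Proof.
apply: (iffP allpairsP) => [[[c w] [/= _ wp ->]]|[c [w wp ->]]].
  by exists c, w.
by exists (c, w); rewrite mem_enum.
Qed.

Lemma spanZ c p v : v \in span p -> iota c * v \in span p.
Proof.
elim: p v => [|x p IH] v; first by rewrite !inE => /eqP ->; rewrite mulr0.
case/span_consP=> c' [w wp ->]; apply/span_consP.
by exists (c * c'), (iota c * w); [exact: IH | rewrite rmorphM mulrDr mulrA].
Qed.

Lemma spanD p v w : v \in span p -> w \in span p -> v + w \in span p.
Proof.
elim: p v w => [|x p IH] v w.
  by rewrite !inE => /eqP -> /eqP ->; rewrite addr0.
case/span_consP=> c [v' vp ->] /span_consP[c' [w' wp ->]]; apply/span_consP.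
by exists (c + c'), (v' + w'); [exact: IH | rewrite rmorphD /=; ring].
Qed.

Lemma monics_span p m : m \in monics p -> m \in span p.
Proof.
elim: p => //= x p IH; rewrite mem_cat => /orP[/IH mp|/mapP[v vp ->]].
  by apply/span_consP; exists 0, m => //; rewrite rmorph0 mul0r add0r.
by apply/span_consP; exists 1, v => //; rewrite rmorph1 mul1r.
Qed.

Lemma monics_neq0 p m : adm p -> m \in monics p -> m != 0.
Proof.
elim: p => //= x p IH /andP[/allP xp ap]; rewrite mem_cat => /orP[/(IH ap) //|].
by case/mapP=> v vp ->; apply: xp.
Qed.

Lemma sum_span_shift p w f : w \in span p ->
  \sum_(v <- span p) f (v + w) = \sum_(v <- span p) f v.
Proof.
elim: p w f => [|x p IH] w f.
  by rewrite inE => /eqP ->; apply: eq_bigr => v _; rewrite addr0.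
case/span_consP=> c [w' wp ->]; rewrite !sum_span_cons.
rewrite [RHS](reindex_inj (addIr c)); apply: eq_bigr => c' _.
rewrite -[RHS](IH w') //; apply: eq_bigr => v _.
by congr f; rewrite rmorphD /=; ring.
Qed.

Lemma sum_span_scale p c f : c != 0 ->
  \sum_(v <- span p) f (iota c * v) = \sum_(v <- span p) f v.
Proof.
move=> c0; elim: p f => [|x p IH] f; first by rewrite !big_seq1 mulr0.
rewrite !sum_span_cons [RHS](reindex_inj (mulfI c0)); apply: eq_bigr => c' _.
rewrite -[RHS]IH; apply: eq_bigr => v _.
by congr f; rewrite rmorphM /=; ring.
Qed.

Lemma sum_span_monics p f :
  \sum_(v <- span p) f v =
    f 0 + \sum_(c : F | c != 0) \sum_(m <- monics p) f (iota c * m).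
Proof.
elim: p f => [|x p IH] f.
  by rewrite big_seq1 big1 ?addr0 // => c _; rewrite big_nil.
rewrite sum_span_cons (bigD1 0) //= rmorph0 mul0r.
under [X in X + _]eq_bigr => v _ do rewrite add0r.
rewrite IH -addrA -big_split; congr (_ + _); apply: eq_bigr => c c0 /=.
rewrite big_cat big_map /=; congr (_ + _).
rewrite -(sum_span_scale _ (fun v => f (iota c * x.1 + v)) c0).
by apply: eq_bigr => v _; rewrite mulrDr.
Qed.

(** This is S_k(n) for t = t_k and [p] the flag below level k; [msum] adds it over all levels of its
    flag. *)
Definition psum (n : nat) (t : K) p : K := \sum_(v <- span p) (t + v) ^- n.

Definition msum (n : nat) p : K := \sum_(m <- monics p) m ^- n.

Lemma msum_cons n x p : msum n (x :: p) = msum n p + psum n x.1 p.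
Proof. by rewrite /msum big_cat big_map. Qed.

(** Pairs of equal denominators give the first term. In all other pairs the denominators differ by c
    m with c nonzero and m monic. Partial fractions and translation in v separate the sum over v
    from the one over m, and the sum of c^-j over c produces [Dco]. *)
Lemma psum_mul a b t k p : (0 < a)%N -> (0 < b)%N -> adm ((t, k) :: p) ->
  psum a t p * psum b t p = psum (a + b) t p +
    \sum_(1 <= j < a + b) iota (Dco F j a b) * psum (a + b - j) t p * msum j p.
Proof.
move=> a0 b0 /= /andP[/allP /= tp ap].
pose X v := (t + v)^-1.
have psumE n : psum n t p = \sum_(v <- span p) X v ^+ n.
  by apply: eq_bigr => v _; rewrite /X exprVn.
have XV v : v \in span p -> t + v != 0 by apply: tp.
pose T j v c m := 
   (-1) ^+ b * ('C(j.-1, b.-1)%:R * (- (iota c * m)^-1) ^+ j * X v ^+ (a + b - j))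
  + (-1) ^+ a * ('C(j.-1, a.-1)%:R * (iota c * m)^-1 ^+ j * X (v + iota c * m) ^+ (a + b - j)).
have step1 : psum a t p * psum b t p = psum (a + b) t p +
   \sum_(v <- span p) \sum_(c : F | c != 0) \sum_(m <- monics p)
      \sum_(1 <= j < a + b) T j v c m.
  rewrite !psumE mulr_suml -big_split /= big_seq [RHS]big_seq.
  apply: eq_bigr => v vp.
  rewrite -(sum_span_shift (fun w => X w ^+ b) vp) mulr_sumr sum_span_monics add0r.
  rewrite exprD; congr (_ + _); apply: eq_bigr => c c0.
  rewrite big_seq [RHS]big_seq; apply: eq_bigr => m mp.
  have cm0 : iota c * m != 0 by rewrite mulf_neq0 ?fmorph_eq0 // (monics_neq0 ap).
  have vcm : t + (v + iota c * m) != 0.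
    by apply: XV; rewrite spanD // spanZ // monics_span.
  rewrite [iota c * m + v]addrC (@partial_fraction _ a b _ _ (iota c * m)^-1); first last.
  - by rewrite addn_gt0 a0.
  - move: (XV v vp) vcm cm0; rewrite /X addrA.
    by move: (t + v) (iota c * m) => z d z0 zd0 d0; field; rewrite d0 z0 zd0.
  by rewrite !ppartE // [(b + a)%N]addnC !mulr_sumr -big_split.
rewrite step1; congr (_ + _).
transitivity (\sum_(1 <= j < a + b) \sum_(c : F | c != 0) \sum_(m <- monics p)
    \sum_(v <- span p) T j v c m).
  rewrite exchange_big [RHS]exchange_big; apply: eq_bigr => c _ /=.
  rewrite exchange_big [RHS]exchange_big; apply: eq_bigr => m _ /=.
  exact: exchange_big.
apply: eq_bigr => j _.
have -> : \sum_(c : F | c != 0) \sum_(m <- monics p) \sum_(v <- span p) T j v c m =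
   \sum_(c : F | c != 0) \sum_(m <- monics p)
     (((-1) ^+ (b + j) * 'C(j.-1, b.-1)%:R + (-1) ^+ a * 'C(j.-1, a.-1)%:R)
       * iota (c ^- j) * psum (a + b - j) t p * m ^- j).
  apply: eq_bigr => c c0; rewrite big_seq [RHS]big_seq; apply: eq_bigr => m mp.
  rewrite big_split /= -!mulr_sumr.
  rewrite (sum_span_shift (fun v => X v ^+ (a + b - j))); last first.
    by rewrite spanZ // monics_span.
  rewrite -psumE fmorphV rmorphXn /= (exprNn (iota c * m)^-1) !exprVn exprMn invfM.
  rewrite [(-1) ^+ (b + j)]exprD; ring.
rewrite exchange_big mulr_sumr; apply: eq_bigr => m _ /=.
rewrite -!mulr_suml -mulr_sumr -rmorph_sum /= sum_expV /Dco.
case: ifP => [dj|_]; last by rewrite !rmorph0 !(mulr0, mul0r).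
(* The sign (-1)^j disappears since q - 1 divides j, and the -1 from the sum over c turns the sign
   exponents b and a into b - 1 and a - 1. *)
have sj : (-1) ^+ j = 1 :> K.
  by have := congr1 iota (signr_dvd_card_pred dj); rewrite rmorph_sign rmorph1.
case: a b a0 b0 {psumE T step1} => [|a] [|b] //= _ _.
rewrite rmorphD !rmorphM !rmorph_sign !rmorph_nat exprD sj rmorphN rmorph1 !exprS.
ring.
Qed.

End Flags.

(** * The linear polynomial of a flag *)

Section FlagPolynomial.

Variables (F : finFieldType) (K : fieldType) (iota : {rmorphism F -> K}).
Implicit Types (p : seq (K * nat)) (f : K -> K).

Local Notation span := (span iota).
Local Notation adm := (adm iota).
Local Notation psum := (psum iota).

Lemma exprD_card (x y : K) : (x + y) ^+ #|F| = x ^+ #|F| + y ^+ #|F|.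
Proof.
apply: exprDn_pchar; have [c pr_c cF] := finPcharP F.
have cK : c \in [pchar K] by rewrite (rmorph_pchar iota).
rewrite (eq_pnat _ (pcharf_eq cK)) -cardsT.
by have := abelem_pgroup (fin_ring_pchar_abelem cF).
Qed.

Lemma iota_card (c : F) : iota c ^+ #|F| = iota c.
Proof. by rewrite -rmorphXn expf_card. Qed.

(** Each product (z - z^q) / (z + c) equals 1 - (z + c)^(q - 1). On summing over c the ones cancel,
    and in the binomial expansion only c^(q - 1) has a nonzero power sum, namely -1. *)
Lemma sum_inv_translates (z : K) : (forall c : F, z + iota c != 0) ->
  (\sum_(c : F) (z + iota c)^-1) * (z - z ^+ #|F|) = 1.
Proof.
move=> zc; rewrite mulr_suml.
rewrite (eq_bigr (fun c => 1 - (z + iota c) ^+ #|F|.-1)) => [|c _]; last first.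
  have -> : z - z ^+ #|F| = (z + iota c) - (z + iota c) ^+ #|F|.
    by rewrite exprD_card iota_card; ring.
  by rewrite mulrBr mulVf // -{1}card_predK exprS mulKf.
rewrite sumrB sumr_const.
have -> : 1 *+ #|F| = 0 :> K by rewrite -(rmorph_nat iota) natr_card rmorph0.
rewrite sub0r; under eq_bigr => c _ do rewrite exprDn.
rewrite exchange_big /= big_ord_recr /= big1 => [|i _]; last first.
  rewrite sumrMnl -mulr_sumr.
  under eq_bigr => c _ do rewrite -rmorphXn.
  rewrite -rmorph_sum /= (_ : \sum_c _ = 0) ?rmorph0 ?mulr0 ?mul0rn //.
  have [->|i0] := posnP i.
    by under eq_bigr => c _ do rewrite expr0; rewrite sumr_const natr_card.
  rewrite (bigD1 0) //= expr0n gtn_eqF // add0r sum_exp ifF //.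
  by apply/negP => /(dvdn_leq i0); rewrite leqNgt ltn_ord.
rewrite add0r binn subnn; under eq_bigr => c _ do rewrite expr0 mul1r mulr1n -rmorphXn.
rewrite -rmorph_sum (bigD1 0) //= expr0n gtn_eqF ?card_pred_gt0 // add0r sum_exp.
by rewrite dvdnn rmorphN rmorph1 opprK.
Qed.

(** For admissible [p] with span W this is e_W: each level composes with X - X^q / s^(q - 1), the
    F-linear polynomial with kernel F s and derivative 1, where s is the previous value at the new
    vector. *)
Fixpoint flagpoly p (X : K) : K :=
  if p is x :: p' then
    flagpoly p' X - flagpoly p' X ^+ #|F| / flagpoly p' x.1 ^+ #|F|.-1
  else X.

Lemma flagpolyD p X Y : flagpoly p (X + Y) = flagpoly p X + flagpoly p Y.
Proof. by elim: p => //= x p ->; rewrite exprD_card; ring. Qed.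

Lemma flagpolyZ p c X : flagpoly p (iota c * X) = iota c * flagpoly p X.
Proof. by elim: p => //= x p ->; rewrite exprMn iota_card; ring. Qed.

Lemma flagpoly0 p : flagpoly p 0 = 0.
Proof. by have := flagpolyZ p 0 0; rewrite rmorph0 !mul0r. Qed.

(* The logarithmic derivative of the additive polynomial vanishing on the
   span, whose derivative is 1. *)
Lemma psum1_flagpoly t k p : adm ((t, k) :: p) -> psum 1 t p * flagpoly p t = 1.
Proof.
elim: p t k => [|[x l] p IH] t k.
  by rewrite adm_cons /psum big_seq1 /= !andbT addr0 => t0; rewrite expr1 mulVf.
rewrite adm_cons => /andP[/allP tp axp]; move/(IH x): (axp) => xs.
have s0 : flagpoly p x != 0.
  by apply/eqP => s0; move/eqP: xs; rewrite s0 mulr0 eq_sym oner_eq0.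
have tc c : psum 1 (iota c * x + t) p * (flagpoly p t + iota c * flagpoly p x) = 1.
  rewrite addrC -flagpolyZ -flagpolyD; apply: (IH _ k).
  move: axp; rewrite !adm_cons => /andP[_ ->]; rewrite andbT.
  apply/allP => v vp; rewrite /= -addrA; apply: (tp (iota c * x + v)).
  by apply/span_consP; exists c, v.
have tc0 c : flagpoly p t + iota c * flagpoly p x != 0.
  by apply/eqP => z0; move/eqP: (tc c); rewrite z0 mulr0 eq_sym oner_eq0.
have -> : psum 1 t ((x, l) :: p) =
    \sum_(c : F) (flagpoly p t + iota c * flagpoly p x)^-1.
  rewrite /psum sum_span_cons /=; apply: eq_bigr => c _.
  rewrite -[RHS]mul1r -(tc c) mulfK //; apply: eq_bigr => v _.
  by rewrite addrA (addrC t).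
(* Dividing by s turns the points Y + c s into the translates of Y / s by F. *)
set s := flagpoly p x in s0 tc0 *; set Y := flagpoly p t in tc0 *.
have Zc c : Y / s + iota c != 0.
  by apply: contra (tc0 c) => /eqP h; rewrite -(mulfVK s0 Y) -mulrDl h mul0r.
rewrite -(sum_inv_translates Zc) !mulr_suml; apply: eq_bigr => c _ /=.
rewrite -/s -/Y expr_div_n -[in s ^+ #|F|]card_predK exprS.
move: (tc0 c); have sq : s ^+ #|F|.-1 != 0 by rewrite expf_neq0.
move: (iota c) (Y ^+ #|F|) (s ^+ _) sq => u v w w0 h2; field.
by rewrite h2 w0 s0.
Qed.

Lemma flagpoly_neq0 t k p : adm ((t, k) :: p) -> flagpoly p t != 0.
Proof.
move=> /psum1_flagpoly h; apply/eqP => s0.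
by move/eqP: h; rewrite s0 mulr0 eq_sym oner_eq0.
Qed.

Lemma psum1E t k p : adm ((t, k) :: p) -> psum 1 t p = (flagpoly p t)^-1.
Proof.
move=> a; rewrite -[RHS]mul1r -(psum1_flagpoly a) mulfK //; exact: flagpoly_neq0 a.
Qed.

Lemma flagpoly_span p v : adm p -> v \in span p -> flagpoly p v = 0.
Proof.
elim: p v => [|[x l] p IH] v; first by rewrite inE => _ /eqP.
move=> axp; have := axp; rewrite adm_cons => /andP[_ ap].
case/span_consP=> c [w wp ->] /=; rewrite flagpolyD flagpolyZ (IH w) // addr0.
rewrite exprMn iota_card -{1}card_predK exprS.
by rewrite mulrA mulfK ?subrr // expf_neq0 // (flagpoly_neq0 axp).
Qed.

Lemma sum_span_cat p1 p2 f :
  \sum_(v <- span (p1 ++ p2)) f v =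
    \sum_(v <- span p1) \sum_(w <- span p2) f (v + w).
Proof.
elim: p1 f => [|x p1 IH] f.
  by rewrite big_seq1; under [RHS]eq_bigr => w _ do rewrite add0r.
rewrite cat_cons !sum_span_cons; apply: eq_bigr => c _; rewrite IH.
by apply: eq_bigr => v _; apply: eq_bigr => w _; rewrite addrA.
Qed.

(** The image of an upper flag in the quotient by W, realised through e_W, with the character
    exponents kept. *)
Definition pushflag p : seq (K * nat) -> seq (K * nat) :=
  map (fun x => (flagpoly p x.1, x.2)).

Lemma span_pushflag p1 p : span (pushflag p p1) = map (flagpoly p) (span p1).
Proof.
elim: p1 => [|x p1 IH] /=; first by rewrite flagpoly0.
rewrite IH map_allpairs; elim: (enum F) => //= c s ->; congr (_ ++ _).
by rewrite -map_comp; apply: eq_map => v /=; rewrite flagpolyD flagpolyZ.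
Qed.

End FlagPolynomial.

(** * Goss polynomials *)

Lemma comps_f_fuel f g k : (k <= f)%N -> (k <= g)%N -> comps_f f k = comps_f g k.
Proof.
elim: f g k => [|f IH] [|g] k; rewrite ?leqn0.
- by [].
- by move=> /eqP ->.
- by move=> _ /eqP ->.
move=> kf kg /=; case: ifP => // k0; congr flatten; apply/eq_in_map => i.
rewrite mem_iota => /andP[i0 _]; congr map; apply: IH.
  by rewrite leq_subLR (leq_trans kf) // -add1n leq_add2r.
by rewrite leq_subLR (leq_trans kg) // -add1n leq_add2r.
Qed.

Lemma comps_succ k :
  comps k.+1 = flatten [seq [seq i :: c | c <- comps (k.+1 - i)] | i <- iota 1 k.+1].
Proof.
have -> : comps k.+1 =
  flatten [seq [seq i :: c | c <- comps_f k (k.+1 - i)] | i <- iota 1 k.+1] by [].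
congr flatten; apply/eq_in_map => i.
rewrite mem_iota => /andP[i0 _]; rewrite /comps (@comps_f_fuel k (k.+1 - i)) //.
by rewrite leq_subLR -add1n leq_add2r.
Qed.

Section Goss.

Variables (F : finFieldType) (K : fieldType) (iota : {rmorphism F -> K}).
Implicit Types (p : seq (K * nat)) (f : K -> K).

Local Notation adm := (adm iota).
Local Notation psum := (psum iota).
Local Notation msum := (msum iota).

(* Minus the sum of v^-j over the nonzero v in the span. *)
Definition dsum j p : K := if (#|F|.-1 %| j)%N then msum j p else 0.

(* The coefficient of u^m in B(u)^-r, for B(u) = 1 + sum_{j >= 1} (dsum j p) u^j. *)
Definition goss_coef (r m : nat) p : K :=
  \sum_(c <- comps m)
    'C(r + size c - 1, size c)%:R * ((-1) ^+ size c * \prod_(i <- c) dsum i p).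

Lemma goss_coefS r m p : goss_coef r m.+1 p =
  - \sum_(1 <= j < m.+2) dsum j p *
      \sum_(c <- comps (m.+1 - j)) 'C(r + size c, (size c).+1)%:R *
         ((-1) ^+ size c * \prod_(i <- c) dsum i p).
Proof.
rewrite /goss_coef comps_succ big_flatten big_map -sumrN /index_iota subn1.
apply: eq_bigr => j _; rewrite big_map mulr_sumr -sumrN; apply: eq_bigr => c _.
by rewrite big_cons /= addnS subn1 /= exprS; ring.
Qed.

Lemma goss_coef_r0 r p : goss_coef r 0 p = 1.
Proof. by rewrite /goss_coef big_seq1 big_nil bin0 !mul1r. Qed.

Lemma goss_coef_0m m p : goss_coef 0 m.+1 p = 0.
Proof.
rewrite goss_coefS big1 ?oppr0 // => j _; rewrite big1 ?mulr0 // => c _.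
by rewrite add0n bin_small ?mul0r.
Qed.

(** Comparison of coefficients in B B^-(r + 1) = B^-r; termwise this is Pascal's rule. *)
Lemma goss_coef_rec r m p :
  goss_coef r.+1 m p + \sum_(1 <= j < m.+1) dsum j p * goss_coef r.+1 (m - j) p =
  goss_coef r m p.
Proof.
case: m => [|m]; first by rewrite big_nil !goss_coef_r0 addr0.
rewrite !goss_coefS -[_ + _]opprK opprD opprK -sumrB; congr (- _).
apply: eq_bigr => j _; rewrite -mulrBr; congr (_ * _); rewrite -sumrB.
apply: eq_bigr => c _; rewrite -mulrBl; congr (_ * _).
by rewrite !addSn subn1 /= binS natrD addrK.
Qed.

(** The n-th Goss polynomial: the generating series over n is u X / (1 - u X / B(u)). *)
Definition gosspoly n p : {poly K} :=
  \poly_(r < n.+1) if r is r'.+1 then goss_coef r' (n - r) p else 0.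

Lemma size_gosspoly n p : (0 < n)%N -> size (gosspoly n p) = n.+1.
Proof.
by case: n => // n _; rewrite size_poly_eq //= subnn goss_coef_r0 oner_neq0.
Qed.

Lemma gosspoly_rec n p : (0 < n)%N ->
  'X * gosspoly n p = gosspoly n.+1 p +
     \sum_(1 <= j < n) dsum j p *: gosspoly (n.+1 - j) p.
Proof.
move=> n0; apply/polyP => r; rewrite coefXM coefD coef_sum.
under eq_bigr => j _ do rewrite coefZ.
rewrite /gosspoly coef_poly; under eq_bigr => j _ do rewrite coef_poly.
case: r => [|r].
  by rewrite coef_poly /= add0r big1 // => j _; rewrite mulr0.
rewrite coef_poly /= ltnS; case: r => [|r] /=.
  (* In the coefficient of X only positive-degree coefficients of B^0 = 1 occur, as j stays below
     n. *)
  case: n n0 => // n _; rewrite subn1 goss_coef_0m add0r big_nat big1 // => j jn.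
  have -> : (n.+2 - j - 1 = (n - j).+1)%N by lia.
  by rewrite goss_coef_0m if_same mulr0.
have [rn|nr] := ltnP r n; last first.
  rewrite ifF ?add0r; last by lia.
  rewrite big_nat big1 // => j jn.
  by rewrite ifF ?mulr0 //; lia.
rewrite [X in X + _]ifT; last by lia.
have -> : (n.+1 - r.+2 = n - r.+1)%N by lia.
rewrite -goss_coef_rec; congr (_ + _).
rewrite [LHS](big_nat_widen _ _ n); last by lia.
rewrite [LHS]big_mkcond; apply: eq_big_nat => j jn.
have -> : (r.+2 < (n.+1 - j).+1)%N = (j < (n - r.+1).+1)%N by lia.
rewrite andTb; case: ifP => _; rewrite ?mulr0 //.
by congr (_ * goss_coef _ _ _); lia.
Qed.

Lemma psum_rec n t k p : (0 < n)%N -> adm ((t, k) :: p) ->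
  psum 1 t p * psum n t p =
    psum n.+1 t p + \sum_(1 <= j < n) dsum j p * psum (n.+1 - j) t p.
Proof.
move=> n0 a; rewrite (psum_mul _ n0 a) // add1n; congr (_ + _).
(* For j < n the second binomial vanishes, so Delta^j_{1,n} is 1 or 0. The term j = n drops out, as
   (-1)^(n - 1) = -1 when q - 1 divides n. *)
rewrite big_nat_recr //= [X in _ + X](_ : _ = 0) ?addr0.
  apply: eq_big_nat => j /andP[j0 jn]; rewrite /Dco /dsum.
  case: ifP => _; last by rewrite rmorph0 !mul0r.
  rewrite bin0 bin_small; last by lia.
  by rewrite mulr0 addr0 mulr1 expr0 rmorph1 mul1r mulrC.
rewrite /Dco; case: ifP => [h|_]; last by rewrite rmorph0 !mul0r.
have := signr_dvd_card_pred h; case: n n0 {a h} => // n _ /=.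
rewrite exprS mulN1r => /(congr1 (@GRing.opp F)); rewrite opprK => ->.
by rewrite binn bin0 expr0 !mulr1 subrr rmorph0 !mul0r.
Qed.

(** [gosspoly_rec] and [psum_rec] are the same recursion, with X in the role of [psum 1 t p], and
    the Goss polynomial of index 1 is X. *)
Lemma psum_goss n t k p : (0 < n)%N -> adm ((t, k) :: p) ->
  psum n t p = (gosspoly n p).[psum 1 t p].
Proof.
move=> n0 a; elim/ltn_ind: n n0 => -[//|[|n]] IH _.
  rewrite horner_poly big_ord_recl big_ord_recl big_ord0 /= mul0r add0r addr0.
  by rewrite goss_coef_r0 mul1r.
have := congr1 (fun q => q.[psum 1 t p]) (@gosspoly_rec n.+1 p isT).
rewrite hornerM hornerX -(IH n.+1) // (psum_rec _ a) // hornerD horner_sum => h.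
apply: (addIr (\sum_(1 <= j < n.+1) dsum j p * psum (n.+2 - j) t p)).
rewrite h; congr (_ + _); apply: eq_big_nat => j /andP[j0 jn].
by rewrite hornerZ -IH //; lia.
Qed.

End Goss.

(** * Evaluation of words *)

Section LinearExtension.

Variables (F : finFieldType) (K : fieldType) (iota : {rmorphism F -> K}).

Definition lift (T : choiceType) (g : T -> K) (d : {malg F[T]}) : K :=
  mmap iota g d.

Lemma liftE (T : choiceType) (g : T -> K) d :
  lift g d = \sum_(k <- msupp d) iota d@_k * g k.
Proof. by []. Qed.

Lemma liftD (T : choiceType) (g : T -> K) d1 d2 :
  lift g (d1 + d2) = lift g d1 + lift g d2.
Proof. exact: mmapD. Qed.

Lemma liftB (T : choiceType) (g : T -> K) d1 d2 :
  lift g (d1 - d2) = lift g d1 - lift g d2.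
Proof. exact: mmapB. Qed.

Lemma lift_sum (T : choiceType) (g : T -> K) I (r : seq I) (P : pred I) d :
  lift g (\sum_(i <- r | P i) d i) = \sum_(i <- r | P i) lift g (d i).
Proof. exact: (raddf_sum (mmap iota g)). Qed.

Lemma liftZ (T : choiceType) (g : T -> K) c d : lift g (c *: d) = iota c * lift g d.
Proof.
rewrite /lift (mmapEw (msuppZ_le _ _)) mmapE mulr_sumr.
by apply: eq_bigr => k _; rewrite mcoeffZ /= rmorphM mulrA.
Qed.

Lemma liftU (T : choiceType) (g : T -> K) k : lift g << k >> = g k.
Proof. by rewrite /lift mmapU /= rmorph1 mul1r. Qed.

Lemma eq_lift (T : choiceType) (g1 g2 : T -> K) d :
  (forall k, k \in msupp d -> g1 k = g2 k) -> lift g1 d = lift g2 d.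
Proof.
by move=> g12; rewrite !liftE; apply: eq_big_seq => k kd; rewrite g12.
Qed.

Lemma lift_scale (T : choiceType) c (g : T -> K) d :
  lift (fun k => c * g k) d = c * lift g d.
Proof. by rewrite !liftE mulr_sumr; apply: eq_bigr => k _; rewrite mulrCA. Qed.

Lemma lift_add (T : choiceType) (g1 g2 : T -> K) d :
  lift (fun k => g1 k + g2 k) d = lift g1 d + lift g2 d.
Proof. by rewrite !liftE -big_split; apply: eq_bigr => k _; rewrite mulrDr. Qed.

Lemma lift_zero (T : choiceType) (d : {malg F[T]}) : lift (fun _ => 0) d = 0.
Proof. by rewrite liftE big1 // => k _; rewrite mulr0. Qed.

Lemma lift_bilinear (S T U : choiceType) (g : U -> K) (f : S -> T -> {malg F[U]}) a b :
  lift g (\sum_(k <- msupp a) \sum_(l <- msupp b) (a@_k * b@_l) *: f k l) =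
    lift (fun k => lift (fun l => lift g (f k l)) b) a.
Proof.
rewrite lift_sum liftE; apply: eq_bigr => k _.
rewrite lift_sum liftE mulr_sumr; apply: eq_bigr => l _.
by rewrite liftZ rmorphM mulrA.
Qed.

Lemma lift_mul (S T : choiceType) (g1 : S -> K) (g2 : T -> K) a b :
  lift (fun k => lift (fun l => g1 k * g2 l) b) a = lift g1 a * lift g2 b.
Proof.
rewrite !liftE mulr_suml; apply: eq_bigr => k _.
by rewrite lift_scale mulrA.
Qed.

Lemma lift_pre x (g : word F -> K) (d : D F) :
  lift g (pre x d) = lift (fun k => g (x :: k)) d.
Proof.
rewrite /pre lift_sum liftE; apply: eq_bigr => k _.
by rewrite liftZ liftU.
Qed.

End LinearExtension.

(** * Multiplicativity of the evaluation for the shuffle product *)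

Section Shuffle.

Variables (F : finFieldType) (K : fieldType) (iota : {rmorphism F -> K}).
Implicit Types (p : seq (K * nat)).

Local Notation adm := (adm iota).
Local Notation psum := (psum iota).
Local Notation msum := (msum iota).
Local Notation lift := (lift iota).

Lemma lw_gt0 (x : letter F) : (0 < lw x)%N.
Proof. by have /andP[] := valP x. Qed.

Lemma lc_neq0 (x : letter F) : lc x != 0.
Proof. by have /andP[] := valP x. Qed.

Lemma val_mkx n (e : F) : (0 < n)%N -> e != 0 -> val (mkx n e) = (n, e).
Proof. by move=> n0 e0; rewrite insubdK // /is_letter /in_mem /= n0. Qed.

(** The nested sum over strictly decreasing levels. The inner fixpoint descends along the flag while
    the word stays fixed, so that both recursions are structural. *)
Fixpoint phi (w : word F) : seq (K * nat) -> K :=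
  if w is x :: w' then
    fix aux p :=
      if p is y :: p' then
        aux p' + iota (lc x) ^+ y.2 * psum (lw x) y.1 p' * phi w' p'
      else 0
  else fun _ => 1.

Arguments phi : simpl never.

Lemma phi0 p : phi [::] p = 1.
Proof. by []. Qed.

Lemma phi_nil x w : phi (x :: w) [::] = 0.
Proof. by []. Qed.

Lemma phi_cons x w y p : phi (x :: w) (y :: p) =
  phi (x :: w) p + iota (lc x) ^+ y.2 * psum (lw x) y.1 p * phi w p.
Proof. by []. Qed.

Lemma phi_mkx j p : (0 < j)%N -> phi [:: mkx j 1] p = msum j p.
Proof.
move=> j0; elim: p => [|y p IH]; first by rewrite /msum big_nil phi_nil.
rewrite phi_cons IH msum_cons /lc /lw val_mkx ?oner_neq0 //=.
by rewrite rmorph1 expr1n mul1r phi0 mulr1.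
Qed.

(** A length bound certifies that the fuel suffices when [shf] is called on words produced by an
    earlier shuffle. *)
Definition bounded n (d : D F) := {in msupp d, forall k, (size k <= n)%N}.

Lemma boundedD n d1 d2 : bounded n d1 -> bounded n d2 -> bounded n (d1 + d2).
Proof.
move=> b1 b2 k kd; have := fsubsetP (msuppD_le d1 d2) _ kd.
by rewrite in_fsetU => /orP[/b1|/b2].
Qed.

Lemma boundedZ n c d : bounded n d -> bounded n (c *: d).
Proof. by move=> b k kd; apply: b; apply: (fsubsetP (msuppZ_le c d)). Qed.

Lemma bounded_sum n (I : eqType) (r : seq I) (d : I -> D F) :
  {in r, forall i, bounded n (d i)} -> bounded n (\sum_(i <- r) d i).
Proof.
move=> b; rewrite big_seq; elim/big_ind: _ => [k||] //; last exact: boundedD.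
by rewrite msupp0 in_fset0.
Qed.

Lemma boundedU n k : (size k <= n)%N -> bounded n << k >>.
Proof. by move=> b l; rewrite msuppU oner_eq0 in_fset1 => /eqP ->. Qed.

Lemma bounded_pre n x d : bounded n d -> bounded n.+1 (pre x d).
Proof. by move=> b; apply: bounded_sum => k /b kd; apply/boundedZ/boundedU. Qed.

Definition ev p (d : D F) : K := lift (phi^~ p) d.

Lemma evU p w : ev p << w >> = phi w p.
Proof. by rewrite /ev liftU. Qed.

(* P is the evaluation of a combination of words starting with x, and e that of the
   combination obtained by deleting x. *)
Definition prefixes x (e P : seq (K * nat) -> K) :=
  P [::] = 0 /\
  (forall y p, P (y :: p) = P p + iota (lc x) ^+ y.2 * psum (lw x) y.1 p * e p).

Lemma prefixes_pre x d : prefixes x (ev^~ d) (ev^~ (pre x d)).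
Proof.
rewrite /ev; split=> [|y p]; first by rewrite lift_pre -[RHS](lift_zero iota d).
by rewrite !lift_pre -lift_scale -lift_add.
Qed.

Lemma ev_shape p (d1 d2 d3 : D F) (c : nat -> F) (d : nat -> D F) n :
  ev p (d1 + d2 + (d3 + \sum_(1 <= j < n) c j *: d j)) =
  ev p d1 + ev p d2 + (ev p d3 + \sum_(1 <= j < n) iota (c j) * ev p (d j)).
Proof.
rewrite /ev 3!liftD lift_sum; congr (_ + (_ + _)).
by apply: eq_bigr => j _; rewrite liftZ.
Qed.

(** Induction on the flag. At a new top level the added part of the product has x alone, y alone or
    both letters at that level; in the last case [psum_mul] gives the diamond terms. Functions of
    the flag stand in for the shuffled combinations, which keeps the fuel out of the argument. *)
Lemma phi_mul x y z (zj : nat -> letter F) a b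
    (e1 e2 e3 P1 P2 P3 : seq (K * nat) -> K) (e4 P4 : nat -> seq (K * nat) -> K) p :
  let n := (lw x + lw y)%N in
  prefixes x e1 P1 -> prefixes y e2 P2 ->
  lw z = n -> lc z = lc x * lc y -> prefixes z e3 P3 ->
  (forall j, (0 < j < n)%N -> [/\ lw (zj j) = (n - j)%N, lc (zj j) = lc x * lc y
     & prefixes (zj j) (e4 j) (P4 j)]) ->
  (forall p, adm p -> e1 p = phi a p * phi (y :: b) p) ->
  (forall p, adm p -> e2 p = phi (x :: a) p * phi b p) ->
  (forall p, adm p -> e3 p = phi a p * phi b p) ->
  (forall j p, (0 < j)%N -> adm p -> e4 j p = msum j p * (phi a p * phi b p)) ->
  adm p ->
  P1 p + P2 p + (P3 p + \sum_(1 <= j < n) iota (Dco F j (lw x) (lw y)) * P4 j p) =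
  phi (x :: a) p * phi (y :: b) p.
Proof.
move=> n [P10 P1S] [P20 P2S] zn zc [P30 P3S] H4 E1 E2 E3 E4.
elim: p => [_|[t k] p IHp atp].
  rewrite P10 P20 P30 big_nat big1 => [|j jn].
    by rewrite !addr0 phi_nil mul0r.
  by have [_ _ [-> _]] := H4 j jn; rewrite mulr0.
have ap : adm p by move: atp; rewrite adm_cons => /andP[].
have {}IHp := IHp ap.
rewrite (eq_big_nat _ _ (F2 := fun j => iota (Dco F j (lw x) (lw y)) * P4 j p +
    iota (lc z) ^+ k * phi a p * phi b p *
      (iota (Dco F j (lw x) (lw y)) * psum (n - j) t p * msum j p))); last first.
  move=> j jn; have [wj cj [_ ->]] := H4 j jn.
  by rewrite E4 ?wj ?cj ?zc //=; [ring | case/andP: jn].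
rewrite big_split -mulr_sumr /=.
have := psum_mul (lw_gt0 x) (lw_gt0 y) atp; rewrite -/n.
move: IHp; set S := \sum_(1 <= j < n) _; set T := \sum_(1 <= j < n) _ => IHp hT.
rewrite P1S P2S P3S E1 // E2 // E3 // zn !phi_cons /= [RHS]mulrDl !mulrDr -IHp.
have -> : iota (lc x) ^+ k * psum (lw x) t p * phi a p *
    (iota (lc y) ^+ k * psum (lw y) t p * phi b p) =
    iota (lc z) ^+ k * phi a p * phi b p * (psum n t p + T).
  by rewrite -hT zc rmorphM exprMn; ring.
ring.
Qed.

Lemma ev_shf fuel (a b : word F) : (size a + size b <= fuel)%N ->
  bounded (size a + size b) (shf fuel a b) /\
  (forall p, adm p -> ev p (shf fuel a b) = phi a p * phi b p).
Proof.
elim: fuel a b => [|fuel IH] [|x a] [|y b] // le_fuel; try (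
  split; [by apply: boundedU; rewrite /= ?addn0 | by move=> p _; rewrite evU phi0 ?mulr1 ?mul1r]).
rewrite /= !addSn !addnS in le_fuel *.

have [B1 E1] : bounded (size a + size b).+1 (shf fuel a (y :: b)) /\
   (forall p, adm p -> ev p (shf fuel a (y :: b)) = phi a p * phi (y :: b) p).
  by have := IH a (y :: b); rewrite /= addnS; apply; lia.
have [B2 E2] : bounded (size a + size b).+1 (shf fuel (x :: a) b) /\
   (forall p, adm p -> ev p (shf fuel (x :: a) b) = phi (x :: a) p * phi b p).
  by have := IH (x :: a) b; rewrite /= addSn; apply; lia.
have [B3 E3] : bounded (size a + size b) (shf fuel a b) /\
   (forall p, adm p -> ev p (shf fuel a b) = phi a p * phi b p).
  by apply: IH; lia.
set d3 := shf fuel a b in B3 E3 *.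
pose d4 j := lin2 (shf fuel) << [:: mkx j (1 : F)] >> d3.
(* Since [k] is at most as long as [a] and [b] together, one extra letter still fits the remaining
   fuel. *)
have H4 j k : k \in msupp d3 -> bounded (size a + size b).+1 (shf fuel [:: mkx j (1 : F)] k) /\
   (forall p, adm p -> ev p (shf fuel [:: mkx j (1 : F)] k) = phi [:: mkx j 1] p * phi k p).
  move=> /B3 kn; have [|B4 E4] := IH [:: mkx j 1] k; first by rewrite /= add1n (leq_ltn_trans kn).
  by split => // l /B4 ln; apply: leq_trans ln _; rewrite /= add1n ltnS.
have B4 j : bounded (size a + size b).+1 (d4 j).
  apply: bounded_sum => k; rewrite msuppU oner_eq0 in_fset1 => /eqP ->.
  by apply: bounded_sum => l /(H4 j)[B _]; apply: boundedZ.
have E4 j p : (0 < j)%N -> adm p -> ev p (d4 j) = msum j p * (phi a p * phi b p).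
  move=> j0 ap; rewrite -(E3 _ ap) -(phi_mkx _ j0) /ev /d4 /lin2 lift_bilinear liftU -lift_scale.
  by apply: eq_lift => k /(H4 j)[_ h]; exact: h.
split; last first.
  move=> p ap; rewrite ev_shape.
  have xy0 : (0 < lw x + lw y)%N by rewrite addn_gt0 lw_gt0.
  have z0 : lc x * lc y != 0 by rewrite mulf_neq0 ?lc_neq0.
  pose zj j := mkx (lw x + lw y - j) (lc x * lc y).
  apply: (phi_mul (zj := zj) (e4 := fun j => ev^~ (d4 j))
    (P4 := fun j => ev^~ (pre (zj j) (d4 j)))
    (prefixes_pre x _) (prefixes_pre y _) _ _ (prefixes_pre (mkx _ _) _)
    _ E1 E2 E3 E4) => //.
  - by rewrite /lw val_mkx.
  - by rewrite /lc val_mkx.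
  - move=> j /andP[j0 jn]; split; [| |exact: prefixes_pre].
    + by rewrite /lw val_mkx ?subn_gt0.
    + by rewrite /lc val_mkx ?subn_gt0.
apply: boundedD; first by apply: boundedD; apply: bounded_pre.
apply: boundedD => [k /(bounded_pre B3) kn|]; first exact: leqW.
by apply: bounded_sum => j _; apply/boundedZ/bounded_pre/B4.
Qed.

Lemma ev_shw (a b : word F) p : adm p ->
  ev p (shw a b) = phi a p * phi b p.
Proof. by case: (ev_shf (leqnn (size a + size b))) => _; apply. Qed.

Lemma ev_sh (a b : D F) p : adm p ->
  ev p (sh a b) = ev p a * ev p b.
Proof.
move=> ap; rewrite /ev /sh /lin2 lift_bilinear -lift_mul.
by apply: eq_lift => k _; apply: eq_lift => l _; exact: ev_shw.
Qed.

End Shuffle.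

Arguments phi : simpl never.

(** * Evaluation of the coproduct *)

Lemma comps_gt0 m c : c \in comps m -> all (leq 1) c.
Proof.
elim/ltn_ind: m c => -[|m] IH c; first by rewrite inE => /eqP ->.
rewrite comps_succ => /flatten_mapP[i]; rewrite mem_iota => /andP[i0 im] /mapP[c' c'm ->].
by rewrite /= i0 (IH _ _ _ c'm) //; lia.
Qed.

Lemma leq_sumn_mem (c : seq nat) i : i \in c -> (i <= sumn c)%N.
Proof.
elim: c => //= j c IH; rewrite inE => /orP[/eqP ->|/IH]; first exact: leq_addr.
by move=> h; apply: leq_trans h _; apply: leq_addl.
Qed.

Section Coproduct.

Variables (F : finFieldType) (K : fieldType) (iota : {rmorphism F -> K}).
Implicit Types (p up low : seq (K * nat)).

Local Notation span := (span iota).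
Local Notation adm := (adm iota).
Local Notation psum := (psum iota).
Local Notation msum := (msum iota).
Local Notation dsum := (dsum iota).
Local Notation goss_coef := (goss_coef iota).
Local Notation flagpoly := (flagpoly F).
Local Notation pushflag := (pushflag F).
Local Notation lift := (lift iota).
Local Notation phi := (phi iota).
Local Notation ev := (ev iota).

(** Each index i is at most the weight w, so the binomial C(i - 1, w) vanishes and Delta^i_{1,w+1}
    is 1 or 0 according to whether q - 1 divides i. *)
Lemma ev_bracket c p : adm p -> all (leq 1) c ->
  ev p (bracket F c) = (-1) ^+ size c * \prod_(i <- c) dsum i p.
Proof.
move=> ap c0.
have evf : ev p (foldr (fun i acc => sh << [:: mkx i (1 : F)] >> acc) << [::] >> c) =
    \prod_(i <- c) msum i p.
  elim: c c0 => [_|i c IH /andP[i0 c0]] /=; first by rewrite big_nil evU.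
  by rewrite ev_sh // evU phi_mkx // IH // big_cons.
rewrite /bracket; set d := foldr _ _ _ in evf *; rewrite /ev liftZ -/(ev p d) evf.
rewrite rmorphM rmorph_sign -mulrA; congr (_ * _).
rewrite rmorph_prod -big_split big_seq [RHS]big_seq; apply: eq_bigr => i ic /=.
have i0 := allP c0 i ic; have iw := leq_sumn_mem ic.
rewrite /Dco /dsum; case: ifP => _; last by rewrite rmorph0 mul0r.
by rewrite bin0 bin_small ?mulr0 ?addr0 ?expr0 ?mulr1 ?rmorph1 ?mul1r //=; lia.
Qed.

Lemma mem_span_cat up low v w :
  v \in span up -> w \in span low -> v + w \in span (up ++ low).
Proof.
elim: up v => [|x up IH] v; first by rewrite inE => /eqP ->; rewrite add0r.
case/span_consP=> c [v' v'up ->] wl; rewrite cat_cons; apply/span_consP.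
by exists c, (v' + w); [exact: IH | rewrite addrA].
Qed.

Lemma adm_catr up low : adm (up ++ low) -> adm low.
Proof. by elim: up => //= x up IH /andP[_ /IH]. Qed.

(** Summing over the lower span first gives a Goss polynomial at 1 / e_W(t + v). As e_W is additive,
    the remaining sum over v is a power sum of the pushed flag. *)
Lemma psum_push n t k up low : (0 < n)%N -> adm ((t, k) :: up ++ low) ->
  psum n t (up ++ low) =
    \sum_(1 <= r < n.+1) goss_coef r.-1 (n - r) low *
       psum r (flagpoly low t) (pushflag low up).
Proof.
move=> n0 a; have [] : all (fun v => t + v != 0) (span (up ++ low)) /\ adm low.
  by move: a; rewrite adm_cons => /andP[h /adm_catr].
move=> /allP /= h alow.
rewrite {1}/psum sum_span_cat.
have -> : \sum_(v <- span up) \sum_(w <- span low) (t + (v + w)) ^- n =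
   \sum_(v <- span up) \sum_(1 <= r < n.+1) goss_coef r.-1 (n - r) low *
      (flagpoly low (t + v)) ^- r.
  rewrite big_seq [RHS]big_seq; apply: eq_bigr => v vup.
  have atv : adm ((t + v, k) :: low).
    rewrite adm_cons alow andbT; apply/allP => w wl /=; rewrite -addrA; apply: h.
    exact: mem_span_cat.
  under eq_bigr => w _ do rewrite addrA.
  rewrite -/(psum n (t + v) low) (psum_goss n0 atv) (psum1E atv) horner_poly.
  rewrite -(big_mkord xpredT (fun i =>
    (match i with 0 => 0 | r'.+1 => goss_coef r' (n - i) low end)
     * (flagpoly low (t + v))^-1 ^+ i)).
  rewrite big_ltn // mul0r add0r; apply: eq_big_nat => -[//|r] _.
  by rewrite exprVn.
rewrite exchange_big; apply: eq_bigr => r _ /=; rewrite -mulr_sumr; congr (_ * _).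
rewrite /psum span_pushflag // big_map; apply: eq_bigr => v _.
by rewrite flagpolyD.
Qed.

Definition ev2 up low (X : DD F) : K :=
  lift (fun w => phi w.1 up * phi w.2 low) X.

Lemma ev2_tens up low a b : ev2 up low (tens a b) = ev up a * ev low b.
Proof.
rewrite /ev2 /tens lift_bilinear -lift_mul.
by apply: eq_lift => k _; apply: eq_lift => l _; rewrite liftU.
Qed.

Lemma ev2_shT up low X Y : adm up -> adm low ->
  ev2 up low (shT X Y) = ev2 up low X * ev2 up low Y.
Proof.
move=> au al; rewrite /ev2 /shT lift_bilinear -lift_mul.
apply: eq_lift => k _; apply: eq_lift => l _.
have := ev2_tens up low (shw k.1 l.1) (shw k.2 l.2); rewrite /ev2 => ->.
by rewrite !ev_shw //; ring.
Qed.

Lemma lift_tensw (g : word F * word F -> K) w (d : D F) :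
  lift g (tensw w d) = lift (fun l => g (w, l)) d.
Proof.
rewrite /tensw lift_sum [RHS]liftE; apply: eq_bigr => l _.
by rewrite liftZ liftU.
Qed.

Lemma ev2_catsh up low X Y : adm low ->
  ev2 up low (catsh X Y) = lift (fun k => lift (fun l =>
     phi k.2 low * (phi (k.1 ++ l.1) up * phi l.2 low)) Y) X.
Proof.
move=> al; rewrite /ev2 /catsh lift_bilinear.
apply: eq_lift => k _; apply: eq_lift => l _.
rewrite lift_tensw /= lift_scale; have := ev_shw k.2 l.2 al; rewrite /ev => ->.
by rewrite mulrCA.
Qed.

(** The evaluated brackets add up to Goss coefficients. The free function [g] leaves room for the
    letters that follow in the left factor. *)
Lemma lift_cop_letter_rest (g : word F -> K) low x : adm low ->
  lift (fun k => phi k.2 low * g k.1) (cop_letter_rest x) =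
  \sum_(1 <= r < (lw x).+1) goss_coef r.-1 (lw x - r) low * g [:: mkx r (lc x)].
Proof.
move=> al; rewrite /cop_letter_rest lift_sum; apply: eq_big_nat => r /andP[r0 _].
rewrite lift_sum /goss_coef mulr_suml big_seq [RHS]big_seq; apply: eq_bigr => c cc.
rewrite liftZ lift_tensw rmorph_nat /=.
under [lift _ _]eq_lift => k _ do rewrite mulrC.
rewrite lift_scale; have := ev_bracket al (comps_gt0 cc); rewrite /ev => ->.
(* Both truncated differences are 0 when r = 1 and [c] is empty. *)
have -> : (r + size c - 2 = r.-1 + size c - 1)%N by lia.
ring.
Qed.

(** Induction on the word, then on [up]. At a new top level, [psum_push] splits the power sum of the
    first letter just as the coproduct splits that letter. *)
Lemma ev2_copw up low w : adm (up ++ low) ->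
  ev2 (pushflag low up) low (copw w) = phi w (up ++ low).
Proof.
elim: w up => [|x v IHv] up a; first by rewrite /ev2 liftU mulr1.
have al := adm_catr a.
(* The term 1 (x) u gives the nested sums whose first letter lies in the lower flag; the others come
   from the rest of the coproduct. *)
have step q : ev2 q low (copw (x :: v)) = phi (x :: v) low +
   \sum_(1 <= r < (lw x).+1) goss_coef r.-1 (lw x - r) low *
     lift (fun l => phi (mkx r (lc x) :: l.1) q * phi l.2 low) (copw v).
  rewrite /ev2 [copw _]/= liftD liftU mul1r; congr (_ + _).
  rewrite -(lift_cop_letter_rest
    (fun k => lift (fun l => phi (k ++ l.1) q * phi l.2 low) (copw v)) x al).
  rewrite -/(ev2 q low _) ev2_catsh //; apply: eq_lift => k _.
  by rewrite lift_scale.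
rewrite step; elim: up a => [_|[t k] up IHup a] /=.
  rewrite big1 ?addr0 // => r _.
  rewrite (_ : lift _ _ = 0) ?mulr0 // -[RHS](lift_zero iota (copw v)).
  by apply: eq_lift => l _; exact: mul0r.
have aup : adm (up ++ low) by move: a; rewrite cat_cons adm_cons => /andP[].
rewrite phi_cons -IHup // -addrA; congr (_ + _).
rewrite (psum_push (lw_gt0 x) a) /= mulr_sumr mulr_suml -big_split.
apply: eq_big_nat => r /andP[r0 _] /=.
rewrite [RHS](_ : _ = goss_coef r.-1 (lw x - r) low *
  (lift (fun l => phi (mkx r (lc x) :: l.1) (pushflag low up) * phi l.2 low) (copw v) +
   iota (lc x) ^+ k * psum r (flagpoly low t) (pushflag low up) * phi v (up ++ low)));
  last by ring.
congr (_ * _); rewrite -(IHv _ aup) /ev2 -lift_scale -lift_add.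
apply: eq_lift => l _; rewrite phi_cons [lc (mkx _ _)]/lc [lw (mkx _ _)]/lw.
by rewrite val_mkx ?lc_neq0 //=; ring.
Qed.

Lemma ev2_cop up low d : adm (up ++ low) ->
  ev2 (pushflag low up) low (cop d) = ev (up ++ low) d.
Proof.
move=> a; rewrite /ev2 /cop lift_sum /ev liftE; apply: eq_bigr => k _.
by rewrite liftZ -/(ev2 _ _ _) ev2_copw.
Qed.

End Coproduct.

(** * Linear independence of evaluations *)

Lemma big_uniq_subset (I : eqType) (V : nmodType) (s s' : seq I) (f : I -> V) :
  uniq s -> uniq s' -> {subset s <= s'} ->
  (forall i, i \notin s -> f i = 0) -> \sum_(i <- s) f i = \sum_(i <- s') f i.
Proof.
move=> us us' ss' f0; rewrite [RHS](bigID (mem s)) /= [X in _ + X]big1 // addr0.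
rewrite -[RHS]big_filter; apply: perm_big; apply: uniq_perm => // [|i].
  exact: filter_uniq.
by rewrite mem_filter; case: (boolP (i \in s)) => //= /ss' ->.
Qed.

Lemma poly_increasing_size_free (K : idomainType) (G : nat -> {poly K}) N (a : nat -> K) :
  (forall m n, (m < n)%N -> (size (G m) < size (G n))%N) -> G 0%N != 0 ->
  \sum_(n < N) a n *: G n = 0 -> forall n, (n < N)%N -> a n = 0.
Proof.
move=> incG G0; elim: N => // N IH sum0.
have GN : G N != 0.
  by case: (posnP N) => [->//|N0]; rewrite -size_poly_gt0 (leq_ltn_trans _ (incG _ _ N0)).
have aN : a N = 0.
  have := congr1 (fun q : {poly K} => q`_(size (G N)).-1) sum0.
  rewrite big_ord_recr /= coefD coefZ coef_sum big1 => [|i _]; last first.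
    rewrite coefZ nth_default ?mulr0 // -ltnS prednK ?size_poly_gt0 //.
    exact: incG.
  move=> /eqP; rewrite add0r coef0 mulf_eq0 -/(lead_coef (G N)) lead_coef_eq0.
  by rewrite (negbTE GN) orbF => /eqP.
move=> n; rewrite ltnS leq_eqVlt => /orP[/eqP -> //|]; apply: IH.
by move: sum0; rewrite big_ord_recr /= aN scale0r addr0.
Qed.

(** If q vanishes everywhere, q + 1 has no root, hence is constant over an algebraically closed
    field. *)
Lemma poly_vanishing_eq0 (K : closedFieldType) (q : {poly K}) :
  (forall x, q.[x] = 0) -> q = 0.
Proof.
move=> q0; have : size (q + 1) == 1%N.
  apply/negPn/negP => /closed_rootP[x]; rewrite rootE !hornerE q0 add0r.
  by rewrite oner_eq0.
case/size_poly1P => c _ /(canRL (addrK _)) qc.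
have := q0 0; rewrite {1}qc hornerD hornerN !hornerC => c1.
by rewrite qc -polyCB c1.
Qed.

Section Independence.

Variables (F : finFieldType) (K : closedFieldType) (iota : {rmorphism F -> K}).
Implicit Types (p up low : seq (K * nat)).

Local Notation span := (span iota).
Local Notation adm := (adm iota).
Local Notation flagpoly := (flagpoly F).
Local Notation pushflag := (pushflag F).
Local Notation phi := (phi iota).
Local Notation ev2 := (ev2 iota).

(** Each level asks for a root of a polynomial of degree q. *)
Lemma flagpoly_surj p z : adm p -> exists t, flagpoly p t = z.
Proof.
elim: p z => [|[x l] p IH] z; first by exists z.
move=> axp; have := axp; rewrite adm_cons => /andP[_ ap].
have : flagpoly p x ^- #|F|.-1 != 0 by rewrite invr_eq0 expf_neq0 // (flagpoly_neq0 axp).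
set b := (_ ^- _) => b0.
have [Y] : exists Y, root (- b *: 'X^#|F| + ('X - z%:P)) Y.
  apply/closed_rootP; rewrite size_polyDl size_scale ?oppr_eq0 // size_polyXn.
    by rewrite eqSS -card_predK.
  by rewrite size_XsubC ltnS finNzRing_gt1.
rewrite rootE hornerD hornerZ hornerXn hornerXsubC => /eqP hY; have [t tY] := IH Y ap.
exists t; rewrite /= tY -/b; apply/eqP; rewrite -subr_eq0 -hY.
by apply/eqP; ring.
Qed.

Lemma adm_flagpoly t k p : adm p -> flagpoly p t != 0 -> adm ((t, k) :: p).
Proof.
move=> ap; apply: contraR; rewrite adm_cons ap andbT => /allPn[v vp].
rewrite negbK /= => /eqP /(congr1 (flagpoly p)).
by rewrite (flagpolyD iota) (flagpoly_span ap vp) addr0 (flagpoly0 iota) => ->.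
Qed.

Lemma span_cat up low x : x \in span (up ++ low) ->
  exists v w, [/\ v \in span up, w \in span low & x = v + w].
Proof.
elim: up x => [|y up IH] x.
  by move=> xl; exists 0, x; rewrite mem_head add0r.
rewrite cat_cons => /span_consP[c [x' /IH[v [w [vu wl ->]]] ->]].
exists (iota c * y.1 + v), w; split=> //; last by rewrite addrA.
by apply/span_consP; exists c, v.
Qed.

(** The vectors are lifted through e_W one at a time; a dependence of the lifts modulo W would push
    forward to one in [up']. Hence every pair of admissible flags is a point to which [ev2_cop]
    applies. *)
Lemma pushflag_surj up' low : adm up' -> adm low ->
  exists2 up, pushflag low up = up' & adm (up ++ low).
Proof.
elim: up' => [|[t' k] up' IH]; first by exists [::].
rewrite adm_cons => /andP[/allP /= at' /IH{}IH] al; have [up pu aul] := IH al.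
have [t tt'] := flagpoly_surj t' al.
exists ((t, k) :: up); first by rewrite /= tt' pu.
rewrite cat_cons adm_cons aul andbT; apply/allP => x /span_cat[v [w [vu wl ->]]] /=.
apply: contraNneq (at' (flagpoly low v) _) => [/(congr1 (flagpoly low))|].
  by rewrite !(flagpolyD iota) (flagpoly0 iota) (flagpoly_span al wl) addr0 tt' => ->.
by rewrite -pu (span_pushflag iota) map_f.
Qed.

Definition headn (w : word F) : nat := if w is x :: _ then lw x else 1.
Definition headc (w : word F) : F := if w is x :: _ then lc x else 1.

Section Slices.

Variables (s : seq (word F)) (c : word F -> K).
Hypothesis vanish : forall p, adm p -> \sum_(w <- s) c w * phi w p = 0.

(** Subtracting the relation at [p] from the one at [(t, k) :: p] leaves the terms whose first
    letter sits at the new level, a polynomial in 1 / e_W(t). *)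
Lemma slice_poly k p : adm p ->
  \sum_(w <- s | w != [::])
     (c w * iota (headc w) ^+ k * phi (behead w) p) *: gosspoly iota (headn w) p = 0.
Proof.
move=> ap; set Q := \sum_(_ <- _ | _) _.
(* The values 1 / e_W(t) cover all of [K] except 0, and the factor X takes care of 0. *)
suff : 'X * Q = 0 by move=> /eqP; rewrite mulf_eq0 polyX_eq0 => /eqP.
apply: poly_vanishing_eq0 => z; rewrite hornerM hornerX.
have [->|z0] := eqVneq z 0; first by rewrite mul0r.
have [t tz] := flagpoly_surj z^-1 ap.
have at' : adm ((t, k) :: p) by apply: adm_flagpoly; rewrite // tz invr_eq0.
rewrite (_ : Q.[z] = 0) ?mulr0 //.
have e : \sum_(w <- s) c w * phi w ((t, k) :: p) - \sum_(w <- s) c w * phi w p = 0.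
  by rewrite !vanish // subrr.
rewrite -[RHS]e -sumrB horner_sum big_mkcond; apply: eq_bigr => -[|x w] _ /=.
  by rewrite subrr.
rewrite phi_cons hornerZ (psum_goss (lw_gt0 x) at') (psum1E at') tz invrK /=.
by ring.
Qed.

(** Goss polynomials of different index have different degrees, so the relation splits by the weight
    of the first letter. *)
Lemma slice_weight k p n0 : (0 < n0)%N -> adm p ->
  \sum_(w <- s | (w != [::]) && (headn w == n0))
     c w * iota (headc w) ^+ k * phi (behead w) p = 0.
Proof.
move=> n00 ap; set f := fun w => c w * iota (headc w) ^+ k * phi (behead w) p.
pose a n := \sum_(w <- s | (w != [::]) && (headn w == n.+1)) f w.
have headn0 w : (0 < headn w)%N by case: w => //= x _; apply: lw_gt0.
pose N := (n0 + \max_(w <- s) headn w).+1.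
have : \sum_(n < N) a n *: gosspoly iota n.+1 p = 0.
  rewrite -[RHS](slice_poly k ap) /a.
  under eq_bigr => n _ do rewrite scaler_suml big_mkcondr.
  rewrite exchange_big big_seq_cond [RHS]big_seq_cond.
  apply: eq_bigr => w /andP[ws _] /=.
  rewrite -big_mkcond /=.
  have wN : ((headn w).-1 < N)%N.
    have : (headn w <= \max_(w <- s) headn w)%N by apply: (leq_bigmax_seq (F := headn)).
    rewrite /N; move: (\max_(w <- s) _) (headn0 w) => M.
    by lia.
  rewrite (big_pred1 (Ordinal wN)) /= => [|n]; first by rewrite prednK.
  by apply/eqP/eqP => [wn|->]; [apply: val_inj; rewrite /= wn | rewrite /= prednK].
move/(poly_increasing_size_free (G := fun n => gosspoly iota n.+1 p)) => /(_ _ _ n0.-1).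
rewrite /a prednK //; apply; last by rewrite /N; lia.
  by move=> m n mn; rewrite !size_gosspoly.
by rewrite -size_poly_eq0 size_gosspoly.
Qed.

(** The exponent k of the new level is free. Combining the relations for all k with the coefficients
    of a polynomial that vanishes on F except at [lc x0] isolates one character. *)
Lemma slice_letter p (x0 : letter F) : adm p ->
  \sum_(w <- s | (w != [::]) && (head x0 w == x0)) c w * phi (behead w) p = 0.
Proof.
move=> ap; pose P : {poly F} := \prod_(y | y != lc x0) ('X - y%:P).
have P0 : P.[lc x0] != 0.
  rewrite horner_prod prodf_seq_neq0; apply/allP => y _; apply/implyP => yx.
  by rewrite !hornerE subr_eq0 eq_sym.
have PE e : e != lc x0 -> P.[e] = 0.
  by move=> ex; rewrite horner_prod (bigD1 e) //= !hornerE subrr mul0r.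
apply: (mulfI (x := iota P.[lc x0])); first by rewrite fmorph_eq0.
rewrite mulr0.
transitivity (\sum_(w <- s | (w != [::]) && (headn w == lw x0))
   iota P.[headc w] * (c w * phi (behead w) p)).
  rewrite mulr_sumr big_mkcond [RHS]big_mkcond; apply: eq_bigr => -[|x w] _ //=.
  have [->|xx0] := eqVneq x x0; first by rewrite eqxx.
  case: ifP => // /eqP wx; rewrite PE ?rmorph0 ?mul0r //.
  apply: contra xx0 => /eqP cx; apply/eqP/val_inj.
  by rewrite [LHS]surjective_pairing [RHS]surjective_pairing; congr (_, _).
under eq_bigr => w _ do rewrite horner_coef rmorph_sum mulr_suml.
rewrite exchange_big big1 // => i _ /=.
rewrite -[RHS](mulr0 (iota P`_i)) -[in RHS](slice_weight i (lw_gt0 x0) ap) mulr_sumr.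
apply: eq_bigr => w _.
by rewrite rmorphM rmorphXn; ring.
Qed.

End Slices.

(** Induction on the word: at the empty flag only the empty word survives, and the slice of a first
    letter is a relation among the tails. *)
Lemma phi_free (s : seq (word F)) (c : word F -> K) : uniq s ->
  (forall p, adm p -> \sum_(w <- s) c w * phi w p = 0) ->
  {in s, forall w, c w = 0}.
Proof.
move=> us van w; elim: w s c us van => [|x0 w IH] s c us van ws.
  have := van [::] isT; rewrite (bigD1_seq [::]) //= big1 => [|[//|x w] _].
    by rewrite addr0 mulr1.
  by rewrite phi_nil mulr0.
pose hd (w : word F) := (w != [::]) && (head x0 w == x0).
have hdE v : hd v -> x0 :: behead v = v by case: v => //= x v /eqP /= ->.
apply: (IH [seq behead v | v <- s & hd v] (fun v => c (x0 :: v))).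
- rewrite map_inj_in_uniq ?filter_uniq // => v1 v2.
  by rewrite !mem_filter => /andP[/hdE h1 _] /andP[/hdE h2 _] e; rewrite -h1 e.
- move=> p ap; rewrite big_map big_filter -[RHS](slice_letter van x0 ap).
  by apply: eq_bigr => v /hdE ->.
by apply/mapP; exists (x0 :: w); rewrite // mem_filter ws /hd /= eqxx.
Qed.

(** [phi_free] is applied twice, first to the left factors with [low] fixed, then to the right
    ones. *)
Lemma ev2_eq0 (X : DD F) :
  (forall up low, adm up -> adm low -> ev2 up low X = 0) -> X = 0.
Proof.
move=> X0; apply/malgP => -[k l]; rewrite mcoeff0.
have [kl|kl] := boolP ((k, l) \in msupp X); last exact: mcoeff_outdom.
pose s1 := undup [seq q.1 | q <- msupp X]; pose s2 := undup [seq q.2 | q <- msupp X].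
have h2 low : adm low -> {in s1, forall k, \sum_(l <- s2) iota X@_(k, l) * phi l low = 0}.
  move=> al; apply: phi_free (undup_uniq _) _ => up au.
  rewrite -[RHS](X0 up low au al) /ev2 liftE.
  rewrite [RHS](big_uniq_subset (s' := [seq (k, l) | k <- s1, l <- s2])).
  - rewrite big_allpairs; apply: eq_bigr => k' _; rewrite mulr_suml.
    by apply: eq_bigr => l' _ /=; ring.
  - exact: fset_uniq.
  - by apply: allpairs_uniq; rewrite ?undup_uniq // => -[? ?] [? ?].
  - move=> [k' l'] q; apply/allpairsP; exists (k', l').
    by rewrite !mem_undup; split=> //; apply/mapP; exists (k', l').
  - by move=> q /mcoeff_outdom ->; rewrite rmorph0 mul0r.
have k1 : k \in s1 by rewrite mem_undup; apply/mapP; exists (k, l).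
have l2 : l \in s2 by rewrite mem_undup; apply/mapP; exists (k, l).
have /eqP := phi_free (undup_uniq _) (fun low al => h2 low al k k1) l2.
by rewrite fmorph_eq0 => /eqP.
Qed.

End Independence.

(* F is the finite field F_q (q = #|F|, a prime power).
   For all words u, v : Delta(u sh v) = Delta(u) sh Delta(v). *)
Theorem theorem6p5 (F : finFieldType) (u v : word F) :
  cop (shw u v) = shT (copw u) (copw v).
Proof.
have [K [iota _]] := countable_algebraic_closure F.
apply/eqP; rewrite -subr_eq0; apply/eqP.
apply: (ev2_eq0 (iota := iota)) => up' low aup al.
have [up pu a] := pushflag_surj aup al.
rewrite /ev2 liftB -!/(ev2 _ _ _ _) ev2_shT // -pu ev2_cop // !ev2_copw //.
by rewrite ev_shw // subrr.
Qed.
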